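(* Let $\mathcal P$ be a (finite) simplicial poset of rank $n$ with $h$-vector $(h_0,\dots,h_n)$. Then $$\sum_{i=0}^n(h_{n-i}-h_{i})t^i=\sum_{\sigma\in\mathcal P}\Bigl(1+(-1)^n\chi(\mathcal P_{\ge\sigma})\Bigr)(t-1)^{n-\mathrm{rk}\,\sigma}.$$ In particular, the Dehn--Sommerville equations $h_i=h_{n-i}$ hold if $\chi(\mathcal P_{\ge\sigma})=(-1)^{n-1}$ for every $\sigma\in\mathcal P$.
   Context: A finite poset $\mathcal P$ is simplicial if it has an initial element $\hat 0$ and each lower segment $[\hat0,\sigma]$ is a boolean lattice; $\mathrm{rk}\,\sigma=k$ (and $\sigma$ is a $(k-1)$-dimensional simplex) if $[\hat 0,\sigma]$ is the face poset of a $(k-1)$-simplex; the rank of $\mathcal P$ is the maximum of ranks of its elements. Let $f_i$ be the number of $i$-dimensional simplices (elements of rank $i+1$) of $\mathcal P$, so $f_{-1}=1$. The $h$-vector $(h_0,\dots,h_n)$ is defined by the polynomial identity $\sum_{i=0}^nh_it^{n-i}=\sum_{i=0}^nf_{i-1}(t-1)^{n-i}$. For $\sigma\in\mathcal P$, $\mathcal P_{\ge\sigma}=\{\tau\in\mathcal P:\tau\ge\sigma\}$ and $\chi(\mathcal P_{\ge\sigma}):=\sum_{\tau\ge\sigma}(-1)^{\mathrm{rk}\,\tau-1}$, with $\mathrm{rk}$ the rank in $\mathcal P$. *)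

(* Defs.v *)
From HB Require Import structures.
From mathcomp Require Import all_boot all_order all_algebra.

Set Implicit Arguments.
Unset Strict Implicit.
Unset Printing Implicit Defensive.

Import Order.TTheory GRing.Theory Num.Theory.
Local Open Scope ring_scope.

Section SimplicialPoset.
Context {d : Order.disp_t} {P : finBPOrderType d}.
Implicit Types (s t : P) (k i : nat).

Definition lower_segment s : {set P} := [set t : P | \bot <= t <= s]%O.

(* The segment [\bot, s] is isomorphic, via f, to the lattice of subsets of
   'I_k, i.e. to the face poset (empty face included) of a (k-1)-simplex.
   Values of f outside the segment are irrelevant. *)
Definition is_simplex s k : bool :=
  [exists f : {ffun P -> {set 'I_k}},
    [forall t1 in lower_segment s, forall t2 in lower_segment s,
       (f t1 \subset f t2) == (t1 <= t2)%O]
    && (f @: lower_segment s == [set: {set 'I_k}])].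

(* The k such that is_simplex s k. It is unique, and automatically < #|P|
   since 2 ^ k = #|lower_segment s|; see rkP. *)
Definition rk s : nat := \max_(k < #|P| | is_simplex s k) k.

Lemma card_simplex s k : is_simplex s k -> (#|lower_segment s| = 2 ^ k)%N.
Proof.
case/existsP=> f /andP[/forall_inP mono /eqP surj].
have -> : (2 ^ k = #|[set: {set 'I_k}]|)%N.
  by rewrite cardsT -cardsT -powersetT card_powerset cardsT card_ord.
rewrite -surj card_in_imset // => x y xs ys fxy.
have le u v : u \in lower_segment s -> v \in lower_segment s ->
    (f u \subset f v) = (u <= v)%O.
  by move=> us vs; apply/eqP; exact: (forall_inP (mono u us)).
by apply/le_anti; rewrite -!le // fxy subxx.
Qed.

Lemma rkP s k : is_simplex s k -> rk s = k.
Proof.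
move=> sk; have cs := card_simplex sk.
have ltk : (k < #|P|)%N.
  by apply: leq_trans (max_card (mem (lower_segment s))); rewrite cs ltn_expl.
rewrite /rk (big_pred1 (Ordinal ltk)) // => j /=.
apply/idP/eqP => [sj|->//]; apply: val_inj => /=.
by apply/eqP; rewrite -(@eqn_exp2l 2) // -(card_simplex sj) cs.
Qed.

End SimplicialPoset.

Section HVector.
Context {d : Order.disp_t} (P : finBPOrderType d).
Implicit Types (k i : nat).

(* The initial element is part of the type of P. *)
Definition simplicial : Prop := forall s : P, exists k, is_simplex s k.

Definition rank : nat := \max_(s : P) rk s.

(* Indexed by rank: nsimplices k is f_(k-1). *)
Definition nsimplices k : nat := #|[set s : P | rk s == k]|.

Definition fpoly : {poly int} :=
  \sum_(i < rank.+1) (nsimplices i)%:Z *: ('X - 1) ^+ (rank - i).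

(* The unique solution of hvecE; only the values at i <= rank matter. *)
Definition hvec i : int := fpoly`_(rank - i).

Lemma hvecE : \sum_(i < rank.+1) hvec i *: 'X^(rank - i) = fpoly.
Proof.
have sz : (size fpoly <= rank.+1)%N.
  apply: (leq_trans (size_sum _ _ _)); apply/bigmax_leqP => i _.
  apply: leq_trans (size_scale_leq _ _) _.
  by rewrite size_exp_XsubC ltnS leq_subr.
rewrite (reindex_inj rev_ord_inj) /=.
transitivity (\poly_(i < rank.+1) fpoly`_i).
  rewrite poly_def; apply: eq_bigr => i _.
  by rewrite subSS /hvec subKn // -ltnS.
apply/polyP => i; rewrite coef_poly; case: ltnP => // lei.
by rewrite nth_default // (leq_trans sz).
Qed.

End HVector.

(* chi (P_(>= s)). The exponent is an integer: it is -1 when t = \bot. *)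
Definition chi_ge {d : Order.disp_t} {P : finBPOrderType d} (s : P) : int :=
  \sum_(t : P | (s <= t)%O) (-1) ^ ((rk t)%:Z - 1).

(* Main.v *)
(** Since [sum h_(n-i) t^i = sum_s (t-1)^(n - rk s)], reversing the polynomial
    gives [sum h_i t^i = sum_u t^(rk u) (1-t)^(n - rk u)].  Expanding
    [t^(rk u) = (1 + (t-1))^(rk u)] as the sum of [(t-1)^(rk u - rk s)] over the
    faces [s <= u] of the boolean lattice below [u] and exchanging the two sums
    turns the coefficient of [(t-1)^(n - rk s)] into [- (-1)^n chi_ge s]. *)
Require Import Defs.
From HB Require Import structures.
From mathcomp Require Import all_boot all_order all_algebra.

Set Implicit Arguments.
Unset Strict Implicit.
Unset Printing Implicit Defensive.

Import Order.TTheory GRing.Theory Num.Theory.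
Local Open Scope ring_scope.

Lemma signz_pred (m : nat) : (-1) ^ (m%:Z - 1) = - (-1) ^+ m :> int.
Proof.
(* At [m = 0] the integer exponent is -1, and the inverse of -1 is again -1. *)
case: m => [|m]; first by [].
by rewrite intS addrAC subrr add0r exprS mulN1r opprK.
Qed.

(** Distribute the product of [k] factors [1 + x]: [A] collects the indices where 1 is chosen, so
    [x] comes from its complement. *)
Lemma sum_exp_subsets (R : comNzRingType) (x : R) k :
  \sum_(A : {set 'I_k}) x ^+ (k - #|A|) = (1 + x) ^+ k.
Proof.
have -> : (1 + x) ^+ k = \prod_(i < k) (1 + x) by rewrite prodr_const card_ord.
rewrite bigA_distr; apply: eq_big => // A _.
rewrite (bigID (mem A)) /= big1 => [|i ->//].
rewrite mul1r (eq_bigr (fun=> x)) => [|i /negbTE->//].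
by rewrite prodr_const -[k in (k - _)%N]card_ord -(cardC A) addKn.
Qed.

Section Reversal.
Variable R : comNzRingType.

(** This is [t^n p(1/t)] when [p] has degree at most [n]. *)
Definition rev_poly n (p : {poly R}) : {poly R} := \poly_(i < n.+1) p`_(n - i).

Lemma rev_poly_sum n (I : finType) (F : I -> {poly R}) :
  rev_poly n (\sum_i F i) = \sum_i rev_poly n (F i).
Proof.
apply/polyP => i; rewrite coef_poly !coef_sum.
case: ifP => lti; first by apply: eq_bigr => j _; rewrite coef_poly lti.
by rewrite big1 // => j _; rewrite coef_poly lti.
Qed.

(** Formally [t^n (1/t - 1)^k]. The induction strips one factor: for [p] of degree at most [n],
    reversing [p * ('X - 1)] at [n.+1] gives the reversal of [p] at [n] times [1 - 'X]. *)
Lemma rev_poly_exp_subX1 n k : (k <= n)%N ->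
  rev_poly n (('X - 1) ^+ k) = 'X^(n - k) * (1 - 'X) ^+ k.
Proof.
elim: k n => [|k IHk] n lekn.
  apply/polyP => i; rewrite !expr0 mulr1 coef_poly coef1 coefXn subn0 subn_eq0.
  by rewrite ltnS; case: ltngtP.
case: n lekn => // n lekn; rewrite subSS !exprSr mulrA -IHk //.
have szp : (size (('X - 1 : {poly R}) ^+ k) <= n.+1)%N.
  by rewrite size_exp_XsubC ltnS.
move: (_ ^+ k) szp => p szp.
apply/polyP => i; rewrite mulrBr mulr1 coef_poly mulrBr mulr1 !coefB !coefMX !coef_poly.
(* The constant term is where the degree bound enters: it kills the coefficient of [p] at [n.+1]. *)
case: i => [|i] /=; first by rewrite !subn0 subr0 [p`_n.+1]nth_default ?subr0.
rewrite !ltnS subSS; case: ltngtP => [ltin|//|->]; rewrite ?subr0 //.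
  by rewrite subn_eq0 leqNgt ltin subnS.
by rewrite subnn.
Qed.

End Reversal.

Section SimplicialPoset.
Context {d : Order.disp_t} {P : finBPOrderType d}.

Lemma card_lower_segment (simplP : simplicial P) (s : P) :
  #|lower_segment s| = (2 ^ rk s)%N.
Proof. by have [k sk] := simplP s; rewrite (rkP sk) (card_simplex sk). Qed.

Lemma rk_le_rank (s : P) : (rk s <= rank P)%N.
Proof. exact: (leq_bigmax s). Qed.

(** The lower segments are nested and have [2 ^ rk] elements. *)
Lemma rk_mono (simplP : simplicial P) (s t : P) :
  (s <= t)%O -> (rk s <= rk t)%N.
Proof.
move=> st; rewrite -(@leq_exp2l 2) // -!card_lower_segment //.
by apply/subset_leq_card/subsetP => v; rewrite !inE !le0x /= => /le_trans->.
Qed.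

Lemma simplex_iso (simplP : simplicial P) (u : P) : exists f : P -> {set 'I_(rk u)},
  [/\ forall s t, (s <= u)%O -> (t <= u)%O -> (f s \subset f t) = (s <= t)%O,
      forall s t, (s <= u)%O -> (t <= u)%O -> f s = f t -> s = t
    & forall A, exists2 s, (s <= u)%O & f s = A].
Proof.
have [k su] := simplP u; rewrite (rkP su).
have /existsP[f /andP[/forall_inP fmono /eqP fsurj]] := su.
have fle s t : (s <= u)%O -> (t <= u)%O -> (f s \subset f t) = (s <= t)%O.
  move=> su' tu; apply/eqP.
  by apply: (forall_inP (fmono s _)); rewrite inE le0x.
exists f; split=> // [s t su' tu fst|A].
  by apply/le_anti; rewrite -(fle s t) // -(fle t s) // fst subxx.
have : A \in f @: lower_segment u by rewrite fsurj inE.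
by case/imsetP=> s; rewrite inE le0x /= => su' ->; exists s.
Qed.

(** The isomorphism of the segment below [u] with the subsets of ['I_(rk u)] turns rank into
    cardinality, which reduces the sum to [sum_exp_subsets]. *)
Lemma sum_faces (simplP : simplicial P) (R : comNzRingType) (x : R)
    (u : P) :
  \sum_(s : P | (s <= u)%O) x ^+ (rk u - rk s) = (1 + x) ^+ rk u.
Proof.
have [f [fle finj fsurj]] := simplex_iso simplP u.
have fimage v : (v <= u)%O -> f @: lower_segment v = powerset (f v).
  move=> vu; apply/setP => A; rewrite inE; apply/imsetP/idP => [[s]|Av].
    by rewrite inE le0x /= => sv ->; rewrite fle // (le_trans sv).
  have [s su fsA] := fsurj A; exists s => //.
  by rewrite inE le0x -fle // fsA.
have finj_in v : (v <= u)%O -> {in lower_segment v &, injective f}.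
  move=> vu s t; rewrite !inE !le0x /= => sv tv.
  by apply: finj; [apply: le_trans sv vu | apply: le_trans tv vu].
(* Count the segment below [s] twice: [2 ^ rk s] elements, in bijection with the powerset of
   [f s]. *)
have rkf s : (s <= u)%O -> rk s = #|f s|.
  move=> su; apply/eqP; rewrite -(@eqn_exp2l 2) // -card_lower_segment //.
  by rewrite -card_powerset -fimage // card_in_imset //; apply: finj_in.
have fT : f @: lower_segment u = [set: {set 'I_(rk u)}].
  apply/setP => A; rewrite inE; apply/imsetP.
  by have [s su <-] := fsurj A; exists s; rewrite // inE le0x.
rewrite -sum_exp_subsets (eq_bigl (mem [set: {set 'I_(rk u)}])); last first.
  by move=> A; rewrite /= inE.
rewrite -fT big_imset /=; last exact: finj_in.
apply: eq_big => [s|s su]; first by rewrite inE le0x.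
by congr (_ ^+ (_ - _)%N); apply: rkf.
Qed.

Lemma fpolyE : fpoly P = \sum_(s : P) ('X - 1) ^+ (rank P - rk s).
Proof.
(* Group the elements by rank; [inord] is faithful here since [rk s <= rank P]. *)
rewrite (partition_big (fun s => inord (rk s) : 'I_(rank P).+1) predT) //=.
apply: eq_bigr => i _.
have rki (s : P) : (inord (rk s) == i) = (rk s == i).
  by rewrite -val_eqE /= inordK // ltnS rk_le_rank.
rewrite (eq_bigr (fun=> ('X - 1) ^+ (rank P - i))) => [|s]; last first.
  by rewrite rki => /eqP->.
rewrite sumr_const /nsimplices -natz scaler_nat; congr (_ *+ _).
by apply: eq_card => s; rewrite inE -rki.
Qed.

Lemma chi_geE (s : P) : chi_ge s = - \sum_(u : P | (s <= u)%O) (-1) ^+ rk u.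
Proof. by rewrite -sumrN; apply: eq_bigr => u _; rewrite signz_pred. Qed.

Lemma rev_fpoly (simplP : simplicial P) :
  rev_poly (rank P) (fpoly P) =
    \sum_(s : P) (- ((-1) ^+ rank P * chi_ge s)) *: ('X - 1) ^+ (rank P - rk s).
Proof.
set n := rank P.
rewrite fpolyE rev_poly_sum -/n.
transitivity (\sum_(u : P) \sum_(s : P | (s <= u)%O)
    ((-1) ^+ n * (-1) ^+ rk u : int) *: ('X - 1 : {poly int}) ^+ (n - rk s)).
  apply: eq_bigr => u _.
  have leun : (rk u <= n)%N := rk_le_rank u.
  (* Pull the sign out of [(1 - 'X) ^+ (n - rk u)], then read ['X] as [1 + ('X - 1)] so that
     [sum_faces] expands its power. *)
  rewrite rev_poly_exp_subX1 ?leq_subr // subKn // -opprB (exprNn (_ - _)).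
  rewrite -[X in X ^+ rk u](addrNK 1) [_ - 1 + 1]addrC -sum_faces // mulr_suml.
  apply: eq_bigr => s su.
  have -> : (-1) ^+ n * (-1) ^+ rk u = (-1) ^+ (n - rk u) :> int.
    by rewrite -{1}(subnK leun) exprD -mulrA -expr2 sqrr_sign mulr1.
  (* The exponents [n - rk u] and [rk u - rk s] add up without truncation because
     [rk s <= rk u <= n]. *)
  rewrite mulrCA -exprD addnC addnBA ?rk_mono // subnK //.
  by rewrite -mul_polyC rmorphXn rmorphN1.
rewrite (exchange_big_dep predT) //=; apply: eq_bigr => s _.
by rewrite -scaler_suml -mulr_sumr chi_geE mulrN opprK.
Qed.

End SimplicialPoset.

Theorem theorem9p1 (d : Order.disp_t) (P : finBPOrderType d) (n : nat)
    (simplP : simplicial P) (rankP : rank P = n) :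
  \sum_(i < n.+1) (hvec P (n - i) - hvec P i) *: 'X^i
    = \sum_(s : P) (1 + (-1) ^+ n * chi_ge s) *: ('X - 1) ^+ (n - rk s)
      :> {poly int}
  /\ ((forall s : P, chi_ge s = (-1) ^ (n%:Z - 1)) ->
      forall i : nat, (i <= n)%N -> hvec P i = hvec P (n - i)).
Proof.
subst n.
have hsum : \sum_(i < (rank P).+1) (hvec P (rank P - i) - hvec P i) *: 'X^i
    = \sum_(s : P) (1 + (-1) ^+ rank P * chi_ge s) *: ('X - 1) ^+ (rank P - rk s)
      :> {poly int}.
  under eq_bigr do rewrite scalerBl.
  under [RHS]eq_bigr do rewrite scalerDl scale1r.
  (* The terms [hvec P (rank P - i)] assemble to [fpoly P], and the terms [hvec P i] to its
     reversal. *)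
  rewrite big_split /= sumrN [RHS]big_split /=; congr (_ + _).
    rewrite -fpolyE -hvecE (reindex_inj rev_ord_inj) /=.
    by apply: eq_bigr => i _; rewrite subSS subKn // -ltnS.
  apply: oppr_inj; rewrite opprK -sumrN.
  under [RHS]eq_bigr do rewrite -scaleNr.
  by rewrite -rev_fpoly // /rev_poly poly_def.
split=> // chiP i lein; apply/eqP; rewrite eq_sym -subr_eq0; apply/eqP.
(* Each summand on the right vanishes, as [(-1)^n (-1)^(n-1) = -1]; then compare coefficients at
   [i]. *)
move: hsum; rewrite [X in _ = X]big1 => [|s _]; last first.
  by rewrite chiP signz_pred mulrN -expr2 sqrr_sign subrr scale0r.
move/(congr1 (fun p : {poly int} => p`_i)).
rewrite -(poly_def _ (fun i => hvec P (rank P - i) - hvec P i)) coef_poly.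
by rewrite ltnS lein coef0.
Qed.
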